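(* Let $E$ be a finite-dimensional real inner-product space, let $U\subset E$ be a nonempty finite set with $U\ne\{0\}$ and $0\in\operatorname{relint}(\operatorname{conv}U)$, and let $A\colon E\to E$ be a symmetric positive-definite linear map with smallest and largest eigenvalues $\lambda_{\min}$ and $\lambda_{\max}$. Set $V:=A^{1/2}U$ and $R:=\max_{v\in V}\|v\|$, where $A^{1/2}$ is the symmetric positive-definite square root of $A$. Let $r>0$ be the relative inradius of $\operatorname{conv}V$ at zero, i.e. the radius of the largest ball centered at zero in $\operatorname{span}V$ that is contained in $\operatorname{conv}V$. Then, for every $B\ge0$, every $B$-approximate $U$-valued trajectory $(z_k)_{k\ge0}$ for $(E,U,A)$ satisfies $$\sup_{k\ge0}\|z_k\|\le\sqrt{\frac{\lambda_{\max}}{\lambda_{\min}}}\,\|z_0\|+\frac1{\sqrt{\lambda_{\min}}}\left(R+\frac{R^2}{2r}+\frac Br\right).$$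
   Context: A $U$-valued trajectory consists of states $(z_k)_{k\ge0}$ in $E$ and increments $(u_k)_{k\ge0}$ in $U$ with $z_{k+1}=z_k+u_k$ for all integers $k\ge0$. It is $B$-approximate for $(E,U,A)$ if $\langle Az_k,u_k\rangle\le\min_{u\in U}\langle Az_k,u\rangle+B$ for every integer $k\ge0$. *)

(* Defs.v *)
From HB Require Import structures.
From mathcomp Require Import all_boot all_order all_algebra.
From mathcomp Require Import finmap.
From mathcomp Require Import boolp classical_sets reals constructive_ereal ereal.
From mathcomp Require Import convex.

Set Implicit Arguments.
Unset Strict Implicit.
Unset Printing Implicit Defensive.

Import Order.TTheory GRing.Theory Num.Theory.
Local Open Scope fset_scope.
Local Open Scope classical_set_scope.
Local Open Scope ring_scope.

Definition is_max (R : realType) (X : set R) (m : R) : Prop :=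
  X m /\ ubound X m.

Definition is_min (R : realType) (X : set R) (m : R) : Prop :=
  X m /\ lbound X m.

Section Convexity.
Context {R : realType} {E : lmodType R}.

Definition conv_hull (C : set E) : set E := smallest (@convex_set R E) C.

Definition affine_set (C : set E) : Prop :=
  forall (x y : E) (t : R), C x -> C y -> C (t *: x + (1 - t) *: y).

Definition aff_hull (C : set E) : set E := smallest affine_set C.

End Convexity.

(* A finite-dimensional real inner-product space is a [vectType] over a
   [realType] together with a symmetric positive-definite bilinear form
   [dot : {dot E for idfun}]. *)
Section InnerProduct.
Context {R : realType} {E : vectType R} (dot : {dot E for idfun}).

Definition ip_norm (x : E) : R := Num.sqrt (dot x x).

Definition relint (C : set E) : set E :=
  [set x | C x /\ exists2 e : R, 0 < e &
     forall y, aff_hull C y -> ip_norm (y - x) < e -> C y].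

Definition symmetric_end (A : 'End(E)) : Prop :=
  forall x y, dot (A x) y = dot x (A y).

Definition posdef_end (A : 'End(E)) : Prop :=
  forall x, x != 0 -> 0 < dot (A x) x.

Definition is_posdef_sqrt (A S : 'End(E)) : Prop :=
  [/\ symmetric_end S, posdef_end S & (S \o S)%VF = A].

Definition is_rel_inradius (V : {fset E}) (r : R) : Prop :=
  is_max [set rho | 0 <= rho /\
            forall x, x \in <<V>>%VS -> ip_norm x <= rho ->
                      conv_hull [set` V] x] r.

Definition is_trajectory (U : {fset E}) (z u : nat -> E) : Prop :=
  forall k : nat, u k \in U /\ z k.+1 = z k + u k.

Definition approximate (U : {fset E}) (A : 'End(E)) (B : R)
    (z u : nat -> E) : Prop :=
  forall k : nat,
    exists2 m, is_min [set dot (A (z k)) w | w in [set` U]] m &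
               dot (A (z k)) (u k) <= m + B.

End InnerProduct.

(* Main.v *)
Require Import Defs.
From HB Require Import structures.
From mathcomp Require Import all_boot all_order all_algebra.
From mathcomp Require Import finmap.
From mathcomp Require Import boolp classical_sets reals constructive_ereal ereal.
From mathcomp Require Import convex ring lra.

(** The change of variables [y = S z] turns [<A z, u>] into the plain inner
    product [<y, v>] with [v = S u], so the trajectory becomes a walk with steps
    in the finite set [V = S U] whose steps are, up to [B], the most opposed to
    the current position.

    Let [p] and [q] be the components of [y] in [span V] and orthogonal to it.
    The component [q] never moves, and the choice of steps only sees [p].  The
    point [- (r / |p|) p] lies in [conv V], and a linear function is at least
    its minimum over [V] at that point, so some [v] in [V] has
    [<p, v> <= - r |p|] ([steepest_descent]).  Hence
    [|p + v|^2 <= |p|^2 - 2 r |p| + 2 B + R^2]: above the threshold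
    [T = R^2 / (2 r) + B / r] the norm of [p] does not grow, and below it one
    step reaches at most [T + R] ([step_bound]).  So [|p|] never exceeds both
    its initial value and [R + T], which gives [trajectory_bound] for [y].

    Going back to [z] needs [lmin |z|^2 <= <A z, z> = |S z|^2 <= lmax |z|^2],
    i.e. that the extreme values of the Rayleigh quotient of a symmetric map are
    eigenvalues.  This is obtained without compactness ([rayleigh_min]): if [m]
    is the greatest lower bound of the quotient, then [T - m] is positive
    semidefinite; were it injective, its inverse would be a bounded map, which
    forces [T - m >= c > 0] and contradicts the choice of [m].  Boundedness of
    linear maps comes from Gram-Schmidt orthogonalisation.

    Finally [r > 0]: the affine hull of [conv U] contains [0], hence [span U],
    so [conv U] contains a ball of [span U]; applying [S], whose inverse is
    bounded, [conv V] contains a ball of [span V] ([inradius_gt0]). *)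

Set Implicit Arguments.
Unset Strict Implicit.
Unset Printing Implicit Defensive.

Import Order.TTheory GRing.Theory Num.Theory.
Local Open Scope fset_scope.
Local Open Scope classical_set_scope.
Local Open Scope ring_scope.

Section InnerProductTheory.
Context {K : realType} {E : vectType K} (dot : {dot E for idfun}).
Implicit Types (x y p e : E) (X : seq E).

Local Notation "''[' x , y ]" := (dot x y) : ring_scope.
Local Notation "''|' x |" := (ip_norm dot x)
  (at level 0, x at level 99, format "''|' x |") : ring_scope.

(** * Norms and orthogonality *)

Lemma dotC x y : '[x, y] = '[y, x].
Proof. by rewrite hermC expr0 mul1r. Qed.

Lemma dotDl x y p : '[x + y, p] = '[x, p] + '[y, p].
Proof. exact: linearDl. Qed.

Lemma dotDr x y p : '[p, x + y] = '[p, x] + '[p, y].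
Proof. exact: linearDr. Qed.

Lemma dotZl (a : K) x y : '[a *: x, y] = a * '[x, y].
Proof. exact: linearZl_LR. Qed.

Lemma dotZr (a : K) x y : '[x, a *: y] = a * '[x, y].
Proof. by rewrite dotC dotZl dotC. Qed.

Lemma dotNl x y : '[- x, y] = - '[x, y].
Proof. exact: linearNl. Qed.

Lemma dotNr x y : '[x, - y] = - '[x, y].
Proof. exact: linearNr. Qed.

Lemma dot0l x : '[0, x] = 0.
Proof. by rewrite -(scale0r 0) dotZl mul0r. Qed.

Definition dotE := (dotDl, dotDr, dotZl, dotZr, dotNl, dotNr).

Lemma dot_gt0 x : x != 0 -> 0 < '[x, x].
Proof. exact: neq0_dnorm_gt0. Qed.

Lemma dot_ge0 x : 0 <= '[x, x].
Proof.
by have [->|/dot_gt0/ltW//] := eqVneq x 0; rewrite dot0l.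
Qed.

Lemma ip_norm_ge0 x : 0 <= '|x|.
Proof. exact: sqrtr_ge0. Qed.

Lemma ip_norm_sqr x : '|x| ^+ 2 = '[x, x].
Proof. by rewrite sqr_sqrtr ?dot_ge0. Qed.

Lemma ip_norm_gt0 x : x != 0 -> 0 < '|x|.
Proof. by move=> x0; rewrite sqrtr_gt0 dot_gt0. Qed.

Lemma ip_norm0 : '|0| = 0.
Proof. by rewrite /ip_norm dot0l sqrtr0. Qed.

Lemma ip_normZ (a : K) x : '|a *: x| = `|a| * '|x|.
Proof.
by rewrite /ip_norm dotZl dotZr mulrA -expr2 sqrtrM ?sqr_ge0// sqrtr_sqr.
Qed.

(** The square of [|y| x - |x| y] is nonnegative, and it equals
    [2 |x| |y| (|x| |y| - <x, y>)]. *)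
Lemma cauchy_schwarz x y : '[x, y] <= '|x| * '|y|.
Proof.
have [->|x0] := eqVneq x 0; first by rewrite dot0l ip_norm0 mul0r.
have [->|y0] := eqVneq y 0; first by rewrite dotC dot0l ip_norm0 mulr0.
have nx := ip_norm_gt0 x0; have ny := ip_norm_gt0 y0.
have := dot_ge0 ('|y| *: x - '|x| *: y).
rewrite !dotE (dotC y x) -!ip_norm_sqr => h.
rewrite -(ler_pM2l (mulr_gt0 nx ny)); lra.
Qed.

Lemma ip_normD x y : '|x + y| <= '|x| + '|y|.
Proof.
rewrite -(@ler_pXn2r _ 2) ?nnegrE ?addr_ge0 ?ip_norm_ge0//.
rewrite ip_norm_sqr !dotE -!ip_norm_sqr (dotC y x).
by have := cauchy_schwarz x y; lra.
Qed.

(** One Gram-Schmidt step: adding [x] to the spanning family adds to the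
    projection of [y] its component along [b], the part of [x] orthogonal to
    the earlier span. *)
Lemma gram_schmidt X y :
  exists2 p, p \in <<X>>%VS & {in <<X>>%VS, forall w, '[w, y - p] = 0}.
Proof.
elim: X y => [|x X IH] y.
  exists 0; first exact: mem0v.
  by move=> w; rewrite span_nil memv0 => /eqP ->; rewrite dot0l.
have [a aX ortha] := IH x; have [p pX orthp] := IH y.
(* If [b = 0], then [x] already lies in the span and [t = 0]. *)
pose b := x - a; pose t := '[b, y - p] / '[b, b].
have inX w : w \in <<X>>%VS -> w \in <<x :: X>>%VS.
  by rewrite span_cons => wX; apply: (subvP (addvSr _ _)).
have bX : b \in <<x :: X>>%VS.
  by apply: rpredB; [exact: memv_span (mem_head _ _) | exact: inX].
exists (p + t *: b); first by rewrite rpredD ?rpredZ// inX.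
move=> w; rewrite span_cons => /memv_addP[_ /vlineP[k ->] [w' w'X ->]].
have -> : k *: x + w' = k *: b + (k *: a + w').
  by rewrite addrA -scalerDr subrK.
have: k *: a + w' \in <<X>>%VS by rewrite rpredD ?rpredZ.
move: (k *: a + w') => v vX.
rewrite opprD addrA dotDl !(dotDr (y - p)) !dotNr !dotZr !dotZl (orthp v)//.
rewrite (ortha v vX : dot v b = 0).
rewrite mulr0 subr0 addr0 mulrCA -mulrBr.
have [b0|b0] := eqVneq b 0; first by rewrite b0 !dot0l mulr0 subrr mulr0.
by rewrite divfK ?subrr ?mulr0// gt_eqF ?dot_gt0.
Qed.

Lemma ip_norm_orthD x y : '[x, y] = 0 -> '|x + y| ^+ 2 = '|x| ^+ 2 + '|y| ^+ 2.
Proof. by move=> xy; rewrite !ip_norm_sqr !dotE (dotC y x) xy; ring. Qed.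

Lemma ler_ip_normDl x y : '[x, y] = 0 -> '|x| <= '|x + y|.
Proof.
move=> xy; rewrite -(@ler_pXn2r _ 2) ?nnegrE ?ip_norm_ge0//.
by rewrite ip_norm_orthD// lerDl sqr_ge0.
Qed.

Lemma ler_ip_normDr x y : '[x, y] = 0 -> '|y| <= '|x + y|.
Proof. by rewrite dotC addrC; apply: ler_ip_normDl. Qed.

(** * Boundedness of linear maps *)

(** In the orthogonal decomposition [x = k b + w'] both summands are at most
    [|x|] in norm, so the bounds of [F] on the line of [b] and on the earlier
    span add up. *)
Lemma lfun_bounded_span (F : 'End(E)) X :
  exists2 C, 0 < C & {in <<X>>%VS, forall x, '|F x| <= C * '|x|}.
Proof.
elim: X => [|e X [C C0 IH]].
  exists 1 => // x; rewrite span_nil memv0 => /eqP ->.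
  by rewrite linear0 mul1r.
have [a aX ortha] := gram_schmidt X e.
pose b := e - a; pose D := '|F b| / '|b|.
exists (D + C); first by rewrite ltr_wpDl// divr_ge0 ?ip_norm_ge0.
move=> x; rewrite span_cons => /memv_addP[_ /vlineP[k ->] [w wX ->]].
have -> : k *: e + w = k *: b + (k *: a + w).
  by rewrite addrA -scalerDr subrK.
set w' := k *: a + w; have w'X : w' \in <<X>>%VS by rewrite rpredD ?rpredZ.
have orth : '[k *: b, w'] = 0 by rewrite dotC dotZr ortha ?mulr0.
rewrite linearD (le_trans (ip_normD _ _))// mulrDl lerD//; last first.
  by rewrite (le_trans (IH _ w'X))// ler_pM2l// ler_ip_normDr.
apply: (@le_trans _ _ (D * '|k *: b|)); last first.
  by rewrite ler_wpM2l ?ler_ip_normDl// divr_ge0 ?ip_norm_ge0.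
rewrite linearZ/= !ip_normZ /D.
have [->|b0] := eqVneq b 0; first by rewrite linear0 ip_norm0 !mulr0 .
by rewrite mulrCA divfK// gt_eqF ?ip_norm_gt0.
Qed.

Lemma lfun_bounded (F : 'End(E)) :
  exists2 C, 0 < C & forall x, '|F x| <= C * '|x|.
Proof.
have [C C0 FC] := lfun_bounded_span F (vbasis fullv).
exists C => // x; apply: FC.
by rewrite (span_basis (vbasisP fullv)) memvf.
Qed.

(** * Extreme eigenvalues of symmetric maps *)

(** With [T y = x] and [C] a bound for the inverse of [T], nonnegativity of the
    form of [T] at [x - t y] reads
    [<T x, x> >= 2 t <x, x> - t^2 <x, y> >= (2 t - t^2 C) <x, x>];
    the best choice [t = 1 / C] gives the constant [1 / C]. *)
Lemma psd_inj_coercive (T : 'End(E)) :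
  symmetric_end dot T -> (forall x, 0 <= '[T x, x]) -> lker T == 0%VS ->
  exists2 c, 0 < c & forall x, c * '[x, x] <= '[T x, x].
Proof.
move=> symT T0 kT; have [C C0 TC] := lfun_bounded (T^-1)%VF.
exists C^-1; first by rewrite invr_gt0.
move=> x; pose y := (T^-1)%VF x.
have Ty : T y = x by rewrite /y lker0_lfunVK.
have xy : '[x, y] <= C * '[x, x].
  rewrite (le_trans (cauchy_schwarz _ _))// -ip_norm_sqr expr2 mulrCA.
  by rewrite ler_wpM2l ?ip_norm_ge0 ?TC.
have := T0 (x - C^-1 *: y).
have -> : T (x - C^-1 *: y) = T x - C^-1 *: x by rewrite linearB linearZ/= Ty.
rewrite !dotE (symT x y) Ty => h.
have h2 : C^-1 * (C^-1 * '[x, y]) <= C^-1 * '[x, x].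
  by rewrite ler_pM2l ?invr_gt0// ler_pdivrMl.
lra.
Qed.

(** The supremum of the lower bounds of the Rayleigh quotient is an eigenvalue:
    otherwise [psd_inj_coercive] would raise it by [c]. *)
Lemma rayleigh_min (T : 'End(E)) e :
  symmetric_end dot T -> e != 0 ->
  exists2 mu, passmx.leigenvalue T mu & forall x, mu * '[x, x] <= '[T x, x].
Proof.
move=> symT e0.
pose L := [set m | forall x, m * '[x, x] <= '[T x, x]].
have [C C0 TC] := lfun_bounded T.
have L0 : L !=set0.
  exists (- C) => x; rewrite mulNr lerNl -dotNl.
  rewrite (le_trans (cauchy_schwarz _ _))// -scaleN1r ip_normZ normrN1 mul1r.
  by rewrite -ip_norm_sqr expr2 mulrA ler_wpM2r ?ip_norm_ge0.
have Lub : has_ubound L.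
  by exists ('[T e, e] / '[e, e]) => m /(_ e); rewrite ler_pdivlMr ?dot_gt0.
have supL : L (sup L).
  move=> x; have [->|x0] := eqVneq x 0; first by rewrite dot0l mulr0 dotC dot0l.
  rewrite -ler_pdivlMr ?dot_gt0//; apply: ge_sup => // m /(_ x).
  by rewrite ler_pdivlMr ?dot_gt0.
exists (sup L) => //.
apply/negP => /eqP; rewrite /passmx.leigenspace; set T' := T - _ => /eqP kT'.
have T'E x : T' x = T x - sup L *: x.
  by rewrite /T' add_lfunE opp_lfunE scale_lfunE id_lfunE.
have [||c c0 T'c] := @psd_inj_coercive T' _ _ kT'.
- by move=> x y; rewrite !T'E !dotE symT.
- by move=> x; rewrite T'E !dotE subr_ge0.
have : L (sup L + c).
  by move=> x; have := T'c x; rewrite T'E !dotE mulrDl; lra.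
by move/(ub_le_sup Lub); lra.
Qed.

Lemma leigenvalueP (T : 'End(E)) a :
  reflect (exists2 x, x != 0 & T x = a *: x) (passmx.leigenvalue T a).
Proof.
rewrite /passmx.leigenvalue -subv0 /passmx.leigenspace.
have ker x : (x \in lker (T - a *: \1)%VF) = (T x == a *: x).
  by rewrite memv_ker add_lfunE opp_lfunE scale_lfunE id_lfunE subr_eq0.
apply: (iffP idP) => [/subvPn[x]|[x x0 Tx]].
  by rewrite ker memv0 => /eqP Tx x0; exists x.
by apply/subvPn; exists x; rewrite ?memv0// ker Tx.
Qed.

(** The upper bound is the lower one for [- T]. *)
Lemma rayleigh_bounds (T : 'End(E)) (lmin lmax : K) :
  symmetric_end dot T ->
  is_min [set a | passmx.leigenvalue T a] lmin ->
  is_max [set a | passmx.leigenvalue T a] lmax ->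
  forall x, lmin * '[x, x] <= '[T x, x] <= lmax * '[x, x].
Proof.
move=> symT [/leigenvalueP[e e0 _] lbT] [_ ubT] x.
apply/andP; split.
  have [mu Tmu /(_ x)] := rayleigh_min symT e0.
  by apply: le_trans; rewrite ler_wpM2r ?dot_ge0 ?lbT.
have symNT : symmetric_end dot (- T).
  by move=> y y'; rewrite !opp_lfunE !dotE symT.
have [mu /leigenvalueP[f f0 Tf] /(_ x)] := rayleigh_min symNT e0.
have Tmu : - mu <= lmax.
  apply: ubT; apply/leigenvalueP; exists f => //.
  by rewrite scaleNr -Tf opp_lfunE opprK.
have := ler_wpM2r (dot_ge0 x) Tmu.
by rewrite opp_lfunE dotNl; lra.
Qed.

(** * Convex and affine hulls *)

Lemma conv_hull_min (C D : set E) :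
  @convex_set K E D -> C `<=` D -> conv_hull C `<=` D.
Proof. by move=> cD CD; apply: smallest_sub. Qed.

Lemma sub_conv_hull (C : set E) : C `<=` conv_hull C.
Proof. exact: sub_gen_smallest. Qed.

Lemma conv_hull_convex (C : set E) : @convex_set K E (conv_hull C).
Proof.
move=> x y l; rewrite !inE => xC yC D [cD CD].
by have := cD x y l; rewrite !inE; apply; [apply: xC | apply: yC].
Qed.

Lemma conv_hull_ge (C : set E) p (m : K) :
  (forall v, C v -> m <= '[p, v]) -> forall x, conv_hull C x -> m <= '[p, x].
Proof.
move=> mC; apply: (@conv_hull_min _ [set x | m <= '[p, x]]) => //.
move=> x y l; rewrite !inE/= => mx my.
rewrite [X in '[p, X]](_ : _ = l%:num *: x + (1 - l%:num) *: y)//.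
have l0 : 0 <= l%:num by [].
have l1 : 0 <= 1 - l%:num by rewrite subr_ge0.
rewrite dotDr !dotZr.
by have := ler_wpM2l l0 mx; have := ler_wpM2l l1 my; lra.
Qed.

Lemma conv_hull_image (F : 'End(E)) (C D : set E) :
  (forall x, C x -> D (F x)) -> forall x, conv_hull C x -> conv_hull D (F x).
Proof.
move=> CD; apply: (@conv_hull_min _ [set x | conv_hull D (F x)]).
  move=> x y l; rewrite !inE/= => Fx Fy.
  rewrite [X in F X](_ : _ = l%:num *: x + (1 - l%:num) *: y)//.
  rewrite linearD !linearZ/=.
  by have := @conv_hull_convex D (F x) (F y) l; rewrite !inE; apply.
by move=> x Cx; apply: sub_conv_hull; apply: CD.
Qed.

Lemma aff_hull_affine (C : set E) : affine_set (aff_hull C).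
Proof.
by move=> x y t Cx Cy D DC; apply: DC.1; [apply: Cx | apply: Cy].
Qed.

(** An affine set through [0] is a linear subspace: it is closed under scaling
    because [k x = k x + (1 - k) 0], and under addition because [x + y] is twice
    the midpoint. *)
Lemma span_sub_affine (D : set E) X :
  affine_set D -> D 0 -> {in X, forall x, D x} -> {in <<X>>%VS, forall x, D x}.
Proof.
move=> aD D0; have DZ k x : D x -> D (k *: x).
  by move=> Dx; have := aD x 0 k Dx D0; rewrite scaler0 addr0.
have DD x y : D x -> D y -> D (x + y).
  move=> Dx Dy; rewrite -[x + y]scale1r -(divff (lt0r_neq0 (ltr0n K 2))).
  rewrite -scalerA; apply: DZ.
  have := aD x y 2^-1 Dx Dy; rewrite (_ : 1 - 2^-1 = 2^-1) ?scalerDr//.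
  by lra.
elim: X => [|a X IH] DX x.
  by rewrite span_nil memv0 => /eqP ->.
rewrite span_cons => /memv_addP[_ /vlineP[k ->] [w wX ->]].
apply: DD; first by apply/DZ/DX; rewrite mem_head.
by apply: IH wX => v vX; apply: DX; rewrite inE vX orbT.
Qed.

(** The relative interior is taken in the affine hull of [conv U] and the
    inradius in [span V]; as [0] lies in [conv U], the former contains [span U],
    and [S] identifies [span U] with [span V] up to the bounded factor [C]. *)
Lemma inradius_gt0 (U : {fset E}) (S : 'End(E)) r :
  relint dot (conv_hull [set` U]) 0 -> lker S == 0%VS ->
  is_rel_inradius dot [fset S w | w in U]%fset r -> 0 < r.
Proof.
move=> [C0 [e e0 eC]] kS [_ rub].
have [C Cp SC] := lfun_bounded (S^-1)%VF.
pose rho := e / (2 * C).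
have rho0 : 0 < rho by rewrite divr_gt0// mulr_gt0.
apply: (lt_le_trans rho0); apply: rub; split=> [|x xV xrho]; first exact: ltW.
pose w := (S^-1)%VF x.
have Sw : S w = x by rewrite /w lker0_lfunVK.
have wU : w \in <<U>>%VS.
  have xI : x \in (S @: <<U>>)%VS.
    rewrite limg_span; apply: (subvP _ _ xV); apply/span_subvP => v.
    move=> /imfsetP[u uU ->]; apply: memv_span; exact: map_f.
  by have /memv_imgP[w' w'U xE] := xI; rewrite /w xE lker0_lfunK.
rewrite -Sw; apply: (@conv_hull_image S [set` U]).
  by move=> u /= uU; apply/imfsetP; exists u.
apply: eC.
  apply: (@span_sub_affine _ U) wU.
  - exact: aff_hull_affine.
  - exact: sub_gen_smallest C0.
  - by move=> u uU; apply: sub_gen_smallest; apply: sub_conv_hull.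
rewrite subr0 (le_lt_trans (SC x))// (le_lt_trans (ler_wpM2l (ltW Cp) xrho))//.
have -> : C * rho = e / 2 by rewrite /rho; field; rewrite gt_eqF.
by lra.
Qed.

(** * Approximately greedy walks *)

(** The lower bound [m] of [<p, .>] on [V] extends to [conv V], and is tested at
    the point of the ball opposite to [p]. *)
Lemma steepest_descent (V : {fset E}) (r m : K) p :
  0 <= r ->
  (forall x, x \in <<V>>%VS -> '|x| <= r -> conv_hull [set` V] x) ->
  p \in <<V>>%VS -> (forall v, v \in V -> m <= '[p, v]) -> m <= - (r * '|p|).
Proof.
move=> r0 ball pV mV.
have [p0|p0] := eqVneq p 0.
  have := @conv_hull_ge [set` V] p m mV 0; rewrite p0 ip_norm0 mulr0 oppr0 dot0l.
  by apply; apply: ball; rewrite ?mem0v ?ip_norm0.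
have np := ip_norm_gt0 p0.
have := @conv_hull_ge [set` V] p m mV (- (r / '|p|) *: p).
rewrite dotZr -ip_norm_sqr.
have -> : - (r / '|p|) * '|p| ^+ 2 = - (r * '|p|).
  by field; rewrite gt_eqF.
apply; apply: ball; first by rewrite rpredZ.
rewrite ip_normZ normrN ger0_norm ?divfK ?gt_eqF//.
by rewrite divr_ge0// ltW.
Qed.

(** [T] is the norm at which the guaranteed decrease [2 r |p|] of [|p|^2]
    balances its possible increase [2 B + R^2]. *)
Lemma step_bound (r R B : K) p v :
  0 < r -> 0 <= B -> '|v| <= R -> '[p, v] <= - (r * '|p|) + B ->
  '|p + v| <= '|p| \/ '|p + v| <= R + R ^+ 2 / (2 * r) + B / r.
Proof.
move=> r0 B0 vR pv; pose T := R ^+ 2 / (2 * r) + B / r.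
have [pT|Tp] := lerP '|p| T.
  by right; rewrite (le_trans (ip_normD _ _))//; rewrite /T in pT; lra.
left; rewrite -(@ler_pXn2r _ 2) ?nnegrE ?ip_norm_ge0//.
have vR2 : '|v| ^+ 2 <= R ^+ 2.
  by rewrite ler_pXn2r ?nnegrE ?ip_norm_ge0// (le_trans _ vR) ?ip_norm_ge0.
rewrite ip_norm_sqr !dotE (dotC v p) -!ip_norm_sqr.
have : 2 * r * T < 2 * r * '|p| by rewrite ltr_pM2l ?mulr_gt0.
have -> : 2 * r * T = R ^+ 2 + 2 * B by rewrite /T; field; rewrite gt_eqF.
lra.
Qed.

(** Only the component [P k] of [y k] in [span V] moves.  When [|P k|] is at most
    its initial value, Pythagoras gives [|y k| <= |y 0|]; otherwise
    [|P k| <= M], and the fixed component [q] costs at most [|y 0|]. *)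
Lemma trajectory_bound (V : {fset E}) (r R B : K) (y v : nat -> E) :
  0 < r -> 0 <= B ->
  (forall x, x \in <<V>>%VS -> '|x| <= r -> conv_hull [set` V] x) ->
  (forall w, w \in V -> '|w| <= R) ->
  (forall k, v k \in V /\ y k.+1 = y k + v k) ->
  (forall k w, w \in V -> '[y k, v k] <= '[y k, w] + B) ->
  forall k, '|y k| <= '|y 0%N| + (R + R ^+ 2 / (2 * r) + B / r).
Proof.
move=> r0 B0 ball VR traj greedy.
set M := R + _ + _.
have [p pV orthp] := gram_schmidt V (y 0%N).
set q := y 0%N - p in orthp.
have yq : y 0%N = p + q by rewrite addrC subrK.
clearbody q.
pose P k := p + \sum_(i < k) v i.
have PS k : P k.+1 = P k + v k by rewrite /P big_ord_recr addrA.
have yE k : y k = P k + q.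
  elim: k => [|k IH]; first by rewrite /P big_ord0 addr0.
  by rewrite (traj k).2 IH PS addrAC.
have PV k : P k \in <<V>>%VS.
  by rewrite rpredD// rpred_sum// => i _; apply: memv_span; apply: (traj i).1.
clearbody P.
have Pq k : '[P k, q] = 0 by apply: orthp.
have PM k : '|P k| <= '|P 0%N| \/ '|P k| <= M.
  elim: k => [|k IH]; first by left.
  rewrite PS; have vV := (traj k).1.
  have Pv : '[P k, v k] <= - (r * '|P k|) + B.
    rewrite -lerBlDr; apply: (steepest_descent (ltW r0) ball (PV k)) => w wV.
    rewrite lerBlDr; have := greedy k w wV; rewrite yE !(dotDl (P k)).
    by rewrite (dotC q w) (dotC q (v k)) !orthp ?memv_span// !addr0.
  have [le|] := step_bound r0 B0 (VR _ vV) Pv; last by right.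
  by case: IH => /(le_trans le); [left|right].
move=> k; have [P0|PkM] := PM k; last first.
  rewrite yE (le_trans (ip_normD _ _))// addrC lerD// yE.
  exact: ler_ip_normDr (Pq _).
have M0 : 0 <= M.
  have R0 : 0 <= R by rewrite (le_trans _ (VR _ (traj 0%N).1)) ?ip_norm_ge0.
  by rewrite !addr_ge0// divr_ge0// ?sqr_ge0 ?mulr_ge0// ltW.
rewrite ler_wpDr// -(@ler_pXn2r _ 2) ?nnegrE ?ip_norm_ge0//.
by rewrite !yE !ip_norm_orthD ?Pq// lerD2r ler_pXn2r ?nnegrE ?ip_norm_ge0.
Qed.

End InnerProductTheory.

(** * The bound in the original coordinates *)

Theorem theorem2 (K : realType) (E : vectType K) (dot : {dot E for idfun})
    (U : {fset E}) (A S : 'End(E)) (lmin lmax R r : K)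
    (U_neq_empty : U != fset0) (U_neq0 : U != [fset 0])
    (U_relint : relint dot (conv_hull [set` U]) 0)
    (A_sym : symmetric_end dot A) (A_pos : posdef_end dot A)
    (lminP : is_min [set a | passmx.leigenvalue A a] lmin)
    (lmaxP : is_max [set a | passmx.leigenvalue A a] lmax)
    (S_sqrt : is_posdef_sqrt dot A S)
    (RP : is_max [set ip_norm dot v | v in [set` [fset S w | w in U]%fset]] R)
    (rP : is_rel_inradius dot [fset S w | w in U]%fset r) :
  0 < r /\
  forall (B : K) (z u : nat -> E),
    0 <= B -> is_trajectory U z u -> approximate dot U A B z u ->
    (ereal_sup (range (fun k : nat => (ip_norm dot (z k))%:E)) <=
     (Num.sqrt (lmax / lmin) * ip_norm dot (z 0%N) +
      (Num.sqrt lmin)^-1 * (R + R ^+ 2 / (2 * r) + B / r))%:E)%E.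
Proof.
have [S_sym S_pos SS] := S_sqrt.
have AE x y : dot (A x) y = dot (S x) (S y) by rewrite -SS comp_lfunE S_sym.
have kS : lker S == 0%VS.
  rewrite -subv0; apply/subvP => x; rewrite memv_ker memv0 => /eqP Sx.
  by apply/contraT => /S_pos; rewrite Sx dot0l ltxx.
have r0 := inradius_gt0 U_relint kS rP.
split=> // B z u B0 traj greedy.
have lmin0 : 0 < lmin.
  have [/leigenvalueP[e e0 Ae] _] := lminP.
  have := A_pos e e0; rewrite Ae dotZl pmulr_lgt0//; exact: dot_gt0.
have rayleigh := rayleigh_bounds A_sym lminP lmaxP.
have slmin : 0 < Num.sqrt lmin by rewrite sqrtr_gt0.
have lower x : Num.sqrt lmin * ip_norm dot x <= ip_norm dot (S x).
  rewrite /ip_norm -sqrtrM ?(ltW lmin0)// -AE ler_wsqrtr//.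
  by have /andP[] := rayleigh x.
have upper x : ip_norm dot (S x) <= Num.sqrt lmax * ip_norm dot x.
  have lmax0 : 0 <= lmax by exact: le_trans (ltW lmin0) (lmaxP.2 _ lminP.1).
  rewrite /ip_norm -sqrtrM// -AE ler_wsqrtr//.
  by have /andP[] := rayleigh x.
have bound k : ip_norm dot (S (z k)) <=
    ip_norm dot (S (z 0%N)) + (R + R ^+ 2 / (2 * r) + B / r).
  apply: (@trajectory_bound _ _ dot [fset S w | w in U]%fset r R B
    (S \o z) (S \o u)) => //=.
  - exact: rP.1.2.
  - by move=> w wV; apply: RP.2; exists w.
  - move=> j; have [uU ->] := traj j; split; last by rewrite linearD.
    by apply/imfsetP; exists (u j).
  - move=> j _ /imfsetP[w wU ->]; have [m [_ mlb] le_m] := greedy j.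
    rewrite -!AE (le_trans le_m)// lerD2r mlb//; by exists w.
apply: ge_ereal_sup => _ [k _ <-]; rewrite lee_fin.
rewrite -(ler_pM2l slmin) (le_trans (lower _))// (le_trans (bound k))//.
rewrite mulrDr mulrA mulVKf ?gt_eqF// lerD2r -sqrtrM ?(ltW lmin0)//.
by rewrite (le_trans (upper _))// [lmin * _]mulrC divfK ?gt_eqF.
Qed.
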